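(* Let $A$ be a unital separable C*-algebra, $\Gamma$ a countable discrete group and $\alpha:\Gamma\to\mathrm{Aut}(A)$ an action. If the reduced crossed product $A\rtimes_{\lambda,\alpha}\Gamma$ is prime, then $\alpha$ is topologically transitive. Conversely, if $(A,\Gamma,\alpha)$ has the intersection property and $\alpha$ is topologically transitive, then $A\rtimes_{\lambda,\alpha}\Gamma$ is prime.
   Context: Ideals are closed and two-sided. A C*-algebra $B$ is prime if $I\cap J\neq(0)$ for every pair of non-zero ideals $I,J\subset B$. $(A,\Gamma,\alpha)$ has the intersection property if every non-zero ideal of $A\rtimes_{\lambda,\alpha}\Gamma$ has non-zero intersection with the canonical copy of $A$. Cuntz semigroup: $M_\infty(A)^+=\bigsqcup_{n\ge1}M_n(A)^+$; for $a\in M_n(A)^+$, $b\in M_m(A)^+$, $a\precsim b$ if there are $v_k\in M_{m,n}(A)$ with $\|v_k^*bv_k-a\|\to0$; $a\approx b$ if $a\precsim b$ and $b\precsim a$; $W(A)=M_\infty(A)^+/\approx$ with classes $\langle a\rangle$, addition $\langle a\rangle+\langle b\rangle=\langle a\oplus b\rangle$, and $\langle a\rangle\le\langle b\rangle$ iff $a\precsim b$. $\alpha$ induces $\hat\alpha_t(\langle a\rangle)=\langle\alpha_t(a)\rangle$ on $W(A)$ (entrywise action on matrices). The action $\alpha$ is topologically transitive if for every pair of non-zero $x,y\in W(A)$ there are $t\in\Gamma$ and a non-zero $z\in W(A)$ with $z\le x$ and $\hat\alpha_t(z)\le y$. *)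

(* Defs.v *)
From HB Require Import structures.
From mathcomp Require Import all_boot all_order all_algebra.
From mathcomp Require Import complex.
From mathcomp Require Import all_classical all_reals all_analysis.

Set Implicit Arguments.
Unset Strict Implicit.
Unset Printing Implicit Defensive.

Import Order.TTheory GRing.Theory Num.Theory.
Import numFieldNormedType.Exports.
Local Open Scope classical_set_scope.
Local Open Scope ring_scope.

(* Unital C*-algebras, the zero algebra included. The norm of a normedModType
   over R[i] takes its values in R[i]. Hierarchy-Builder has no join of the ring
   and the normed module structures, so the carrier is a separate constant on
   which both are declared. *)
Record cstarAlgType (R : realType) := CStarAlg {
  cstar_space : completeNormedModType R[i];
  cstar_mul : cstar_space -> cstar_space -> cstar_space;
  cstar_one : cstar_space;
  cstar_star : cstar_space -> cstar_space;
  cstar_mulA : associative cstar_mul;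
  cstar_mul1l : left_id cstar_one cstar_mul;
  cstar_mul1r : right_id cstar_one cstar_mul;
  cstar_mulDl : left_distributive cstar_mul +%R;
  cstar_mulDr : right_distributive cstar_mul +%R;
  cstar_mulZl : forall (c : R[i]) a b,
    cstar_mul (c *: a) b = c *: cstar_mul a b;
  cstar_mulZr : forall (c : R[i]) a b,
    cstar_mul a (c *: b) = c *: cstar_mul a b;
  cstar_normM : forall a b, `|cstar_mul a b| <= `|a| * `|b|;
  cstar_starK : involutive cstar_star;
  cstar_starD : {morph cstar_star : a b / a + b};
  cstar_starZ : forall (c : R[i]) a, cstar_star (c *: a) = c^* *: cstar_star a;
  cstar_starM : forall a b,
    cstar_star (cstar_mul a b) = cstar_mul (cstar_star b) (cstar_star a);
  cstar_identity : forall a, `|cstar_mul (cstar_star a) a| = `|a| ^+ 2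
}.

Definition cstar_carrier (R : realType) (A : cstarAlgType R) : Type :=
  cstar_space A.
Coercion cstar_carrier : cstarAlgType >-> Sortclass.

HB.instance Definition _ (R : realType) (A : cstarAlgType R) :=
  CompleteNormedModule.copy (cstar_carrier A) (cstar_space A).
HB.instance Definition _ (R : realType) (A : cstarAlgType R) :=
  GRing.Zmodule_isPzRing.Build (cstar_carrier A) (@cstar_mulA R A)
    (@cstar_mul1l R A) (@cstar_mul1r R A) (@cstar_mulDl R A) (@cstar_mulDr R A).

Definition star {R : realType} {A : cstarAlgType R} : A -> A :=
  @cstar_star R A.

Definition separable (T : topologicalType) : Prop :=
  exists2 S : set T, countable S & dense S.

Section CStarNotions.
Context {R : realType}.

Definition rnorm {A : cstarAlgType R} (a : A) : R := complex.Re `|a|.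

Definition star_hom (A B : cstarAlgType R) (f : A -> B) : Prop :=
  [/\ linear f, monoid_morphism f & {morph f : a / star a}].

Definition ideal (A : cstarAlgType R) (I : set A) : Prop :=
  [/\ closed I, I 0, (forall a b, I a -> I b -> I (a + b)),
      (forall (c : R[i]) a, I a -> I (c *: a)) &
      (forall a b, I a -> I (b * a) /\ I (a * b))].

Definition prime_cstar (A : cstarAlgType R) : Prop :=
  forall I J : set A, ideal I -> ideal J ->
    I <> [set 0] -> J <> [set 0] -> I `&` J <> [set 0].

Record cstar_action (G : groupType) (A : cstarAlgType R) := CStarAction {
  act :> G -> A -> A;
  act_star_hom : forall t, star_hom (act t);
  act_bij : forall t, bijective (act t);
  act_mul : forall s t a, act (s * t)%g a = act s (act t a)
}.

Definition finsupp {G : groupType} {A : cstarAlgType R} (f : G -> A) : Prop :=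
  finite_set [set t | f t <> 0].

(* The norm `|<xi, xi>|^(1/2) of the Hilbert A-module l^2(G, A), on its dense
   submodule of finitely supported functions. *)
Definition l2norm {G : groupType} {A : cstarAlgType R} (xi : G -> A) : R :=
  Num.sqrt (rnorm (\sum_(s \in [set: G]) star (xi s) * xi s)).

(* The regular representation of f = \sum_t f_t u_t in C_c(G, A), where a in A
   acts by (a xi)(s) = alpha_{s^-1}(a) xi(s) and (u_t xi)(s) = xi(t^-1 s). *)
Definition regular_rep {G : groupType} {A : cstarAlgType R}
    (alpha : cstar_action G A) (f xi : G -> A) : G -> A :=
  fun s => \sum_(t \in [set: G]) alpha (s^-1)%g (f t) * xi (t^-1 * s)%g.

Definition reduced_norm {G : groupType} {A : cstarAlgType R}
    (alpha : cstar_action G A) (f : G -> A) : \bar R :=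
  ereal_sup [set (l2norm (regular_rep alpha f xi))%:E
            | xi in [set xi : G -> A | finsupp xi /\ l2norm xi <= 1]].

(* The reduced crossed product is the completion of the *-algebra C_c(G, A) for
   the reduced norm; as such it is only determined up to a unique isomorphism
   respecting the images of A and G, and this record is the type of all its
   realizations. *)
Record reduced_crossed_product {G : groupType} {A : cstarAlgType R}
    (alpha : cstar_action G A) := ReducedCrossedProduct {
  rcp_alg :> cstarAlgType R;
  rcp_emb : A -> rcp_alg;
  rcp_unit : G -> rcp_alg;
  rcp_emb_hom : star_hom rcp_emb;
  rcp_unit_mul : forall s t, rcp_unit (s * t)%g = rcp_unit s * rcp_unit t;
  rcp_unitary : forall t, star (rcp_unit t) * rcp_unit t = 1
                       /\ rcp_unit t * star (rcp_unit t) = 1;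
  rcp_covariant : forall t a,
    rcp_unit t * rcp_emb a * star (rcp_unit t) = rcp_emb (alpha t a);
  rcp_norm : forall f : G -> A, finsupp f ->
    (rnorm (\sum_(t \in [set: G]) rcp_emb (f t) * rcp_unit t))%:E
      = reduced_norm alpha f;
  rcp_dense : dense [set \sum_(t \in [set: G]) rcp_emb (f t) * rcp_unit t
                    | f in [set f : G -> A | finsupp f]]
}.

Definition intersection_property {G : groupType} {A : cstarAlgType R}
    {alpha : cstar_action G A} (B : reduced_crossed_product alpha) : Prop :=
  forall I : set B, ideal I -> I <> [set 0] ->
    I `&` range (@rcp_emb G A alpha B) <> [set 0].

Section Cuntz.
Context {A : cstarAlgType R}.

Definition adjmx {m n} (x : 'M[A]_(m, n)) : 'M[A]_(n, m) :=
  map_mx star (trmx x).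

(* The norm of the Hilbert A-module A^n, and the C*-norm of matrices as
   operators between such modules. *)
Definition cvnorm {n} (xi : 'cV[A]_n) : R :=
  Num.sqrt (rnorm ((adjmx xi *m xi) ord0 ord0)).

Definition mxnorm {m n} (x : 'M[A]_(m, n)) : \bar R :=
  ereal_sup [set (cvnorm (x *m xi))%:E
            | xi in [set xi : 'cV[A]_n | cvnorm xi <= 1]].

(* The disjoint union of the M_n(A), n >= 1; here n = a.(msize).+1. *)
Record Minf := MkMinf { msize : nat; mval : 'M[A]_(msize.+1) }.

Definition Minf_pos : set Minf :=
  [set a | exists y : 'M[A]_((msize a).+1), mval a = adjmx y *m y].

Definition cuntz_sub (a b : Minf) : Prop :=
  exists v : nat -> 'M[A]_((msize b).+1, (msize a).+1),
    mxnorm (adjmx (v k) *m mval b *m v k - mval a) @[k --> \oo] --> 0%E.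

Definition cuntz_equiv (a b : Minf) : Prop := cuntz_sub a b /\ cuntz_sub b a.

Definition cuntz_class (a : Minf) : set Minf :=
  [set b | Minf_pos b /\ cuntz_equiv a b].

(* The Cuntz semigroup W(A), as a set of equivalence classes. *)
Definition cuntz_semigroup : set (set Minf) := cuntz_class @` Minf_pos.

Definition cuntz_zero : set Minf := cuntz_class (MkMinf (0 : 'M[A]_1)).

Definition cuntz_le (x y : set Minf) : Prop :=
  exists a b, [/\ x a, y b & cuntz_sub a b].

Definition act_Minf {G : groupType} (alpha : cstar_action G A) (t : G)
    (a : Minf) : Minf :=
  MkMinf (map_mx (alpha t) (mval a)).

(* As alpha_t is an automorphism, the image of the class of a is exactly the
   class of alpha_t(a). *)
Definition cuntz_act {G : groupType} (alpha : cstar_action G A) (t : G)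
    (x : set Minf) : set Minf := act_Minf alpha t @` x.

Definition topologically_transitive {G : groupType} (alpha : cstar_action G A) :
    Prop :=
  forall x y, cuntz_semigroup x -> cuntz_semigroup y ->
    x <> cuntz_zero -> y <> cuntz_zero ->
    exists t z, [/\ cuntz_semigroup z, z <> cuntz_zero, cuntz_le z x &
                    cuntz_le (cuntz_act alpha t z) y].

End Cuntz.
End CStarNotions.

(* Main.v *)
Require Import Defs.
From HB Require Import structures.
From mathcomp Require Import all_boot all_order all_algebra.
From mathcomp Require Import complex.
From mathcomp Require Import all_classical all_reals all_analysis.
From mathcomp Require Import ring lra.
Import Order.TTheory GRing.Theory Num.Theory.
Import numFieldNormedType.Exports.
Local Open Scope classical_set_scope.
Local Open Scope ring_scope.
Set Implicit Arguments.
Unset Strict Implicit.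
Unset Printing Implicit Defensive.

(** Both implications compare ideals with Cuntz subequivalence.

    If the crossed product [B] is prime and [a], [b] are nonzero positive
    elements of [A], then [a^(1/2) B b^(1/2)] is nonzero ([prime_mul_neq0]), so
    some [X = a^(1/2) c alpha_t(b^(1/2))] is nonzero, because the elements
    [c u_t] span a dense subspace of [B]. The elements [star X * X] and
    [X * star X] lie below [a] and [alpha_t(b)] respectively, and a
    power of [star X * X] lies below both; its class is the one required by transitivity. Matrices reduce to elements
    of [A] by passing to a nonzero diagonal entry
    ([prime_topologically_transitive]).

    Conversely, let [I] and [J] be nonzero ideals of [B]. By the intersection
    property they contain nonzero positive elements of [A], and transitivity
    yields a nonzero positive matrix [d] such that [d] lies below the first and
    [alpha_t(d)] below the second. Since the entries of a matrix below an element
    of an ideal stay in that ideal ([cuntz_sub_ideal]), the entries of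
    [alpha_t(d)] belong to [I] and to [J]; here [I] is stable under [alpha_t],
    which is inner in [B] ([topologically_transitive_prime]).

    Both arguments rest on the order structure of a C*-algebra: positive
    elements have square roots ([positive_sqrt]), form a cone on which the norm
    is monotone ([rnorm_positiveD]), and include all [star x * x]
    ([positive_starM]). Consequently the norm of a column dominates its entries,
    which links the matrix norms of the Cuntz order to the norm of [A], and
    *-homomorphisms are contractive, which makes the trace on [A] of an ideal of
    [B] closed. This order structure is obtained without functional calculus,
    from the C*-identity and a convergent iteration for the square root. *)

(** * Norm, involution and approximation *)

Section Norm.
Context {R : realType} {A : cstarAlgType R}.
Implicit Types (a b x y z : A) (r e : R).

Lemma rnormE a : `|a| = (rnorm a)%:C%C.
Proof.
have := @ger0_Im R _ (normr_ge0 a); rewrite /rnorm.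
by case: (Num.norm _) => u v /= ->.
Qed.

Lemma rnorm_ge0 a : 0 <= rnorm a.
Proof. by rewrite -lecR -rnormE; exact: normr_ge0. Qed.

Lemma rnormD a b : rnorm (a + b) <= rnorm a + rnorm b.
Proof. by rewrite -lecR rmorphD /= -!rnormE ler_normD. Qed.

Lemma rnormN a : rnorm (- a) = rnorm a.
Proof. by rewrite /rnorm normrN. Qed.

Lemma rnormB a b : rnorm (a - b) <= rnorm a + rnorm b.
Proof. by rewrite -(rnormN b) rnormD. Qed.

Lemma rnormM a b : rnorm (a * b) <= rnorm a * rnorm b.
Proof. by rewrite -lecR rmorphM /= -!rnormE; exact: cstar_normM. Qed.

Lemma rnorm0 : rnorm (0 : A) = 0.
Proof. by rewrite /rnorm normr0. Qed.

Lemma rnorm_eq0 a : rnorm a = 0 -> a = 0.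
Proof. by move=> a0; apply/eqP; rewrite -normr_eq0 rnormE a0. Qed.

Lemma rnorm_small r a : 0 <= r -> (forall e, 0 < e -> rnorm a <= r * e) -> a = 0.
Proof.
move=> r0 small; apply: rnorm_eq0; apply/eqP; rewrite eq_le rnorm_ge0 andbT.
rewrite leNgt; apply/negP => a0.
have r1 : 0 < r + 1 by lra.
have := small (rnorm a / (r + 1)) (divr_gt0 a0 r1).
rewrite mulrCA mulrC ler_pMl // ler_pdivlMr //; lra.
Qed.

Lemma rnormZ r a : 0 <= r -> rnorm (r%:C%C *: a) = r * rnorm a.
Proof.
move=> r0; apply: complexI; rewrite rmorphM /= -!rnormE normrZ ger0_norm //.
by rewrite lecR.
Qed.

Lemma mulZl (c : R[i]) a b : (c *: a) * b = c *: (a * b).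
Proof. exact: cstar_mulZl. Qed.

Lemma mulZr (c : R[i]) a b : a * (c *: b) = c *: (a * b).
Proof. exact: cstar_mulZr. Qed.

Lemma starK : involutive (@star R A).
Proof. exact: cstar_starK. Qed.

Lemma starD : {morph (@star R A) : a b / a + b}.
Proof. exact: cstar_starD. Qed.

Lemma starM a b : star (a * b) = star b * star a.
Proof. exact: cstar_starM. Qed.

Lemma star0 : star (0 : A) = 0.
Proof. by apply: (addrI (star 0)); rewrite -starD !addr0. Qed.

Lemma starN a : star (- a) = - star a.
Proof. by apply: (addrI (star a)); rewrite -starD !subrr star0. Qed.

Lemma starB a b : star (a - b) = star a - star b.
Proof. by rewrite starD starN. Qed.

Lemma star1 : star (1 : A) = 1.
Proof. by rewrite -[LHS]mulr1 -{2}(starK 1) -starM mulr1 starK. Qed.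

Lemma starZ r a : star (r%:C%C *: a) = r%:C%C *: star a.
Proof.
rewrite [LHS]cstar_starZ; congr (_ *: _).
by rewrite conj_Creal // complex_real.
Qed.

Lemma starZi a : star ('i%C *: a) = - ('i%C *: star a).
Proof. by rewrite [LHS]cstar_starZ complexiE conjCi scaleNr. Qed.

Lemma rnorm_starM a : rnorm (star a * a) = rnorm a ^+ 2.
Proof.
apply: complexI; rewrite rmorphXn /= -!rnormE; exact: cstar_identity.
Qed.

(** The C*-identity gives [|b|^2 <= |star b| |b|]; applied to [b] and to [star b]
    this makes the involution isometric. *)
Lemma rnorm_star a : rnorm (star a) = rnorm a.
Proof.
suff H b : rnorm b <= rnorm (star b).
  by apply/eqP; rewrite eq_le -{2}(starK a) !H.
have [->|b0] := eqVneq (rnorm b) 0; first exact: rnorm_ge0.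
have {b0}b0 : 0 < rnorm b by rewrite lt0r b0 rnorm_ge0.
by rewrite -(ler_pM2r b0) -expr2 -rnorm_starM rnormM.
Qed.

Lemma rnorm1_le1 : rnorm (1 : A) <= 1.
Proof.
have := rnorm_starM 1; rewrite star1 mul1r => H; nra.
Qed.

Lemma starM_eq0 a : star a * a = 0 -> a = 0.
Proof.
move=> a0; apply: rnorm_eq0; apply/eqP.
by rewrite -sqrf_eq0 -rnorm_starM a0 rnorm0.
Qed.

Lemma sqr_eq0_sa a : star a = a -> a * a = 0 -> a = 0.
Proof. by move=> sa a0; apply: starM_eq0; rewrite sa. Qed.

Lemma rnorm_sqr_sa a : star a = a -> rnorm (a * a) = rnorm a ^+ 2.
Proof. by move=> sa; rewrite -rnorm_starM sa. Qed.

Lemma closed_approx (S : set A) x : closed S ->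
  (forall e, 0 < e -> exists2 y, S y & rnorm (x - y) < e) -> S x.
Proof.
move=> clS approx; apply: clS => U /nbhs_ballP[e /= e0 eU].
have eE : e = (complex.Re e)%:C%C.
  by move/ltW/ger0_Im: e0; case: (e) => u v /= ->.
rewrite eE ltcR in e0.
have [y Sy xy] := approx _ e0; exists y; split=> //; apply: eU.
by rewrite -ball_normE /= rnormE eE ltcR.
Qed.

Lemma approx_closed (S : set A) :
  (forall x, (forall e, 0 < e -> exists2 y, S y & rnorm (x - y) < e) -> S x) ->
  closed S.
Proof.
move=> approx x clx; apply: approx => e e0.
have /clx[y [Sy xy]] : nbhs x (ball x e%:C%C) by apply: nbhsx_ballx; rewrite ltcR.
by exists y => //; move: xy; rewrite -ball_normE /= rnormE ltcR.
Qed.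

Lemma dense_approx (S : set A) x e : dense S -> 0 < e ->
  exists2 y, S y & rnorm (x - y) < e.
Proof.
move=> dS e0; have ec : 0 < e%:C%C :> R[i] by rewrite ltcR.
have nx : nbhs x (ball x e%:C%C) by exact: nbhsx_ballx.
have [|y [/interior_subset xy Sy]] :=
    dS (interior (ball x e%:C%C)) _ (open_interior _).
  by exists x.
by exists y => //; move: xy; rewrite -ball_normE /= rnormE ltcR.
Qed.

(** Convergence by comparison with a bounded real sequence: it gives square
    roots even at the boundary of the disc of convergence, where no geometric
    estimate is available. *)
Lemma dominated_lim (u : nat -> A) (s : nat -> R) r :
  (forall n, rnorm (u n.+1 - u n) <= s n.+1 - s n) -> (forall n, s n <= r) ->
  exists l, forall e, 0 < e ->
    exists N, forall n, (N <= n)%N -> rnorm (l - u n) <= e.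
Proof.
move=> us sr.
have s_incr n : s n <= s n.+1.
  by rewrite -subr_ge0 (le_trans (rnorm_ge0 _) (us n)).
have s_mono : {homo s : n m / (n <= m)%N >-> n <= m} by apply/nondecreasing_seqP.
have us2 n m : (n <= m)%N -> rnorm (u m - u n) <= s m - s n.
  move=> /subnK <-; elim: (m - n)%N => [|k IH].
    by rewrite !add0n !subrr rnorm0.
  rewrite addSn -(subrKA (u (k + n)%N)) (le_trans (rnormD _ _)) //.
  by rewrite (le_trans (lerD (us _) IH)) // subrKA.
have s_cvg : s @ \oo --> limn s.
  by apply: nondecreasing_is_cvgn => //; exists r => _ [n _ <-].
have s_cauchy e : 0 < e -> exists N, forall n, (N <= n)%N -> limn s - s n < e.
  move=> e0; have /cvgrPdist_lt/(_ _ e0)[N _ HN] := s_cvg.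
  by exists N => n /HN /=; apply: le_lt_trans; exact: ler_norm.
have s_lim n : s n <= limn s.
  by apply: nondecreasing_cvgn_le => //; apply/cvg_ex; exists (limn s).
have u_cauchy e : 0 < e ->
    exists N, forall n m, (N <= n)%N -> (n <= m)%N -> rnorm (u m - u n) < e.
  move=> e0; have [N HN] := s_cauchy _ e0; exists N => n m Nn nm.
  apply: le_lt_trans (us2 _ _ nm) _; apply: le_lt_trans (HN _ Nn).
  by rewrite lerD2r.
have [l ul] : exists l : A, u @ \oo --> l.
  apply/cvg_ex; apply: cauchy_cvg; apply: cauchy_exP => e e0.
  have eE : e = (complex.Re e)%:C%C.
    by move/ltW/ger0_Im: e0; case: (e) => c v /= ->.
  rewrite eE ltcR in e0; have [N HN] := u_cauchy _ e0.
  exists (u N), N => //= n /= Nn.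
  by rewrite /= -ball_normE /= distrC rnormE eE ltcR HN.
exists l => e e0; have [N HN] := u_cauchy _ e0.
have ec : 0 < e%:C%C :> R[i] by rewrite ltcR.
exists N => n Nn; rewrite -(addr0 e); apply/ler_addgt0Pr => d d0.
have dc : 0 < d%:C%C :> R[i] by rewrite ltcR.
have /cvgrPdist_lt/(_ _ dc)[M _ HM] := ul.
have := HM (maxn n M) (leq_maxr _ _); rewrite /= rnormE ltcR => lM.
rewrite -(subrKA (u (maxn n M))) (le_trans (rnormD _ _)) // addrC addr0.
by apply: lerD (ltW lM); rewrite ltW // HN // leq_maxl.
Qed.

End Norm.

(** * Square roots near the unit *)

Section SquareRoot.
Context {R : realType} {A : cstarAlgType R}.
Implicit Types (a b g h k x y z : A) (r e : R).

Let half : R[i] := (2^-1 : R)%:C%C.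

Lemma half2 a : half *: (a + a) = a.
Proof.
by rewrite -mulr2n -scaler_nat scalerA /half -(rmorph_nat (real_complex R)) -rmorphM /=
  mulVf ?scale1r // pnatr_eq0.
Qed.

(** With [g = 1 - h], the equation [(1 - q)^2 = h] reads [q = (g + q^2) / 2];
    this is its fixed-point iteration. *)
Fixpoint sqrt_seq g n : A :=
  if n is n'.+1 then half *: (g + sqrt_seq g n' * sqrt_seq g n') else 0.

(** The same iteration run on the number 1, which majorizes it term by term. *)
Fixpoint sqrt_bound n : R :=
  if n is n'.+1 then (1 + sqrt_bound n' ^+ 2) / 2 else 0.

Lemma sqrt_bound_ge0_le1 n : 0 <= sqrt_bound n <= 1.
Proof. by elim: n => [|n /= /andP[? ?]]; [rewrite /= lexx ler01|nra]. Qed.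

Lemma rnorm_half a : rnorm (half *: a) = rnorm a / 2.
Proof. by rewrite rnormZ ?invr_ge0 ?ler0n // mulrC. Qed.

Lemma sqrt_seq_sa g n : star g = g -> star (sqrt_seq g n) = sqrt_seq g n.
Proof.
by move=> gs; elim: n => [|n IH] /=; rewrite ?star0 // starZ starD starM gs IH.
Qed.

Lemma comm_scale (c : R[i]) x y : GRing.comm x y -> GRing.comm x (c *: y).
Proof. by rewrite /GRing.comm mulZr mulZl => ->. Qed.

Lemma sqrt_seq_comm g n z : GRing.comm z g -> GRing.comm z (sqrt_seq g n).
Proof.
move=> zg; elim: n => [|n IH] /=; first exact: commr0.
by apply: comm_scale; apply: commrD => //; exact: commrM.
Qed.

Lemma sqrt_seq_norm g n : rnorm g <= 1 -> rnorm (sqrt_seq g n) <= sqrt_bound n.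
Proof.
move=> g1; elim: n => [|n IH] /=; first by rewrite rnorm0.
rewrite rnorm_half; have := rnormD g (sqrt_seq g n * sqrt_seq g n).
have := rnormM (sqrt_seq g n) (sqrt_seq g n).
have := rnorm_ge0 (sqrt_seq g n); have := sqrt_bound_ge0_le1 n; nra.
Qed.

(** All iterates are polynomials in [g], hence commute, so that two consecutive
    steps satisfy [v' - v = (v - u) (v + u) / 2]; the majorizing sequence
    satisfies the same recurrence. *)
Lemma sqrt_seq_step g n : rnorm g <= 1 ->
  rnorm (sqrt_seq g n.+1 - sqrt_seq g n) <= sqrt_bound n.+1 - sqrt_bound n.
Proof.
move=> g1; elim: n => [|n IH].
  by rewrite /= mulr0 addr0 !subr0 rnorm_half expr0n addr0 ler_pM2r ?invr_gt0 ?ltr0n.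
set u := sqrt_seq g n in IH *; set v := sqrt_seq g n.+1 in IH *.
have -> : sqrt_seq g n.+2 - v = half *: ((v - u) * (v + u)).
  have uv : GRing.comm v u.
    apply: sqrt_seq_comm; apply: commr_sym; exact: sqrt_seq_comm.
  rewrite mulrBl !mulrDr -uv opprD addrA addrK.
  rewrite -[sqrt_seq g n.+2]/(half *: (g + v * v)).
  rewrite {3}/v -[sqrt_seq g n.+1]/(half *: (g + u * u)).
  by rewrite -scalerBr opprD addrACA subrr add0r.
have := sqrt_seq_norm n g1; have := sqrt_seq_norm n.+1 g1; rewrite -/u -/v => vb ub.
rewrite rnorm_half; have := rnormM (v - u) (v + u).
have := rnormD v u; have := rnorm_ge0 (v - u); have := rnorm_ge0 (v + u).
rewrite -[sqrt_bound n.+2]/((1 + sqrt_bound n.+1 ^+ 2) / 2).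
have : sqrt_bound n.+1 = (1 + sqrt_bound n ^+ 2) / 2 by [].
have := sqrt_bound_ge0_le1 n; have := sqrt_bound_ge0_le1 n.+1.
move: (rnorm ((v - u) * _)) (rnorm (v + u)) (rnorm (v - u)) IH vb ub.
move: (sqrt_bound n.+1) (sqrt_bound n) (rnorm u) (rnorm v) => t s nu nv p pl mi.
move=> IH vb ub /andP[s0 s1] /andP[t0 t1] E pl0 mi0 pll pp.
have : mi * pl <= (t - s) * (t + s) by apply: ler_pM => //; lra.
nra.
Qed.

(** The square root is a limit of polynomials in [h], which is why it commutes
    with everything that commutes with [h]. *)
Lemma sqrt_unit h : star h = h -> rnorm (1 - h) <= 1 ->
  exists k, [/\ star k = k, rnorm (1 - k) <= 1, k * k = h &
                forall z, GRing.comm z h -> GRing.comm z k].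
Proof.
set g := 1 - h => hs g1; pose u := sqrt_seq g.
have gs : star g = g by rewrite starB star1 hs.
have [|q uq] := @dominated_lim R A u sqrt_bound 1 (fun n => sqrt_seq_step n g1).
  by move=> n; have /andP[] := sqrt_bound_ge0_le1 n.
have u1 n : rnorm (u n) <= 1.
  by apply: le_trans (sqrt_seq_norm n g1) _; have /andP[] := sqrt_bound_ge0_le1 n.
have qs : star q = q.
  apply/eqP; rewrite -subr_eq0; apply/eqP; apply: (@rnorm_small _ _ 2) => // e e0.
  have [N /(_ N (leqnn _)) HN] := uq _ e0.
  have -> : star q - q = star (q - u N) - (q - u N).
    by rewrite starB sqrt_seq_sa // opprB addrA subrK.
  by rewrite (le_trans (rnormB _ _)) // rnorm_star; lra.
have q1 : rnorm q <= 1.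
  apply/ler_addgt0Pr => e e0; have [N /(_ N (leqnn _)) HN] := uq _ e0.
  by rewrite -(subrK (u N) q) (le_trans (rnormD _ _)) // addrC lerD.
have qE : q + q = g + q * q.
  (* Each occurrence of [q] on the left is replaced by an iterate at distance
     at most [e], and all factors have norm at most 1. *)
  apply/eqP; rewrite -subr_eq0; apply/eqP.
  apply: (@rnorm_small _ _ 4) => // e e0.
  have [N HN] := uq _ e0; have {}HN n := HN n.
  have H0 := HN _ (leqnn N); have H1 := HN _ (leqnSn N).
  have -> : q + q - (g + q * q)
      = (q - u N.+1) + (q - u N.+1) + (u N * (u N - q) + (u N - q) * q).
    have -> : u N.+1 = half *: (g + u N * u N) by [].
    set w := half *: _; have -> : g = w + w - u N * u N.
      by rewrite -scalerDr half2 addrK.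
    rewrite mulrBr mulrBl.
    have -> : u N * u N - u N * q + (u N * q - q * q) = u N * u N - q * q.
      by rewrite addrA subrK.
    by rewrite [in RHS](addrACA q) !opprD opprK !addrA.
  have := rnormD (q - u N.+1 + (q - u N.+1)) (u N * (u N - q) + (u N - q) * q).
  have := rnormD (q - u N.+1) (q - u N.+1).
  have := rnormD (u N * (u N - q)) ((u N - q) * q).
  have := rnormM (u N) (u N - q); have := rnormM (u N - q) q.
  have := u1 N; have := rnorm_ge0 (u N - q); have := rnorm_ge0 (u N).
  have := rnorm_ge0 q; move: H0; rewrite -(rnormN (q - u N)) opprB => H0.
  nra.
exists (1 - q); split.
- by rewrite starB star1 qs.
- by rewrite opprB addrCA subrr addr0.
- rewrite mulrBl mul1r mulrBr mulr1 opprB addrA addrAC -(addrA 1) -opprD qE.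
  by rewrite opprD addrA subrK /g opprB addrCA subrr addr0.
move=> z zh; apply: commrB; first exact: commr1.
have zg : GRing.comm z g by apply: commrB => //; exact: commr1.
apply/eqP; rewrite -subr_eq0; apply/eqP; have z0 := rnorm_ge0 z.
apply: (@rnorm_small _ _ (2 * rnorm z)) => [|e e0]; first by rewrite mulr_ge0.
have [N /(_ N (leqnn _)) HN] := uq _ e0.
have -> : z * q - q * z = z * (q - u N) - (q - u N) * z.
  by rewrite mulrBr mulrBl (sqrt_seq_comm N zg) opprB addrA subrK.
have := rnormB (z * (q - u N)) ((q - u N) * z).
have := rnormM z (q - u N); have := rnormM (q - u N) z; nra.
Qed.

End SquareRoot.

(** * Positive elements *)

Section Positivity.
Context {R : realType} {A : cstarAlgType R}.
Implicit Types (a b g h k x y z : A) (r e : R).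

(** The Kelley-Vaught form of positivity: the spectrum of [a] lies in the disc of
    centre [r] and radius [r]. It involves no spectral theory, and closure under
    addition is the triangle inequality. *)
Definition positive a : Prop :=
  star a = a /\ exists2 r : R, 0 <= r & rnorm (r%:C%C *: (1 : A) - a) <= r.

Lemma scaleCD r e a : (r + e)%:C%C *: a = r%:C%C *: a + e%:C%C *: a.
Proof. by rewrite rmorphD scalerDl. Qed.

Lemma rnorm_scale1 r : 0 <= r -> rnorm (r%:C%C *: (1 : A)) <= r.
Proof. by move=> r0; rewrite rnormZ // ler_piMr // rnorm1_le1. Qed.

Lemma positiveD a b : positive a -> positive b -> positive (a + b).
Proof.
move=> [sa [r r0 ar]] [sb [e e0 be]]; split; first by rewrite starD sa sb.
exists (r + e); first exact: addr_ge0.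
by rewrite scaleCD opprD addrACA (le_trans (rnormD _ _)) // lerD.
Qed.

Lemma positive0 : positive 0.
Proof.
by split; [exact: star0|exists 0 => //; rewrite scale0r subr0 rnorm0].
Qed.

Lemma positive_gt0 a : positive a ->
  exists2 r, 0 < r & rnorm (r%:C%C *: (1 : A) - a) <= r.
Proof.
move=> [_ [r r0 ar]]; exists (r + 1); first by rewrite ltr_wpDl.
rewrite scaleCD addrAC (le_trans (rnormD _ _)) // lerD //.
by rewrite (le_trans (rnorm_scale1 _)).
Qed.

Lemma commZ1 (c : R[i]) a : GRing.comm a (c *: (1 : A)).
Proof. by rewrite /GRing.comm mulZr mulZl mulr1 mul1r. Qed.

Lemma scaleCA r e a : r%:C%C *: (e%:C%C *: a) = (r * e)%:C%C *: a.
Proof. by rewrite scalerA -rmorphM. Qed.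

Lemma positive_sqrt a : positive a ->
  exists k, [/\ positive k, k * k = a &
                forall z, GRing.comm z a -> GRing.comm z k].
Proof.
move=> pa; have [r r0 ar] := positive_gt0 pa; have [sa _] := pa.
have rV0 : 0 <= r^-1 by rewrite invr_ge0 ltW.
have rN0 : r != 0 by rewrite gt_eqF.
have [||k [sk k1 kk kz]] := @sqrt_unit R A (r^-1%:C%C *: a).
- by rewrite starZ sa.
- have -> : 1 - r^-1%:C%C *: a = r^-1%:C%C *: (r%:C%C *: (1 : A) - a).
    by rewrite scalerBr scaleCA mulVf // scale1r.
  by rewrite rnormZ // mulrC ler_pdivrMr // mul1r.
have s0 : 0 <= Num.sqrt r by exact: sqrtr_ge0.
exists ((Num.sqrt r)%:C%C *: k); split.
- split; first by rewrite starZ sk.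
  exists (Num.sqrt r) => //.
  by rewrite -scalerBr rnormZ // ler_piMr.
- by rewrite mulZl mulZr kk !scaleCA -expr2 sqr_sqrtr ?(ltW r0) // mulfV // scale1r.
- by move=> z za; apply: comm_scale; apply: kz; exact: comm_scale.
Qed.

Lemma rnormZi a : rnorm ('i%C *: a) = rnorm a.
Proof. by apply: complexI; rewrite -!rnormE normrZ complexiE normCi mul1r. Qed.

Lemma scaleii a : 'i%C *: ('i%C *: a) = - a.
Proof. by rewrite scalerA -expr2 sqr_i scaleN1r. Qed.

Lemma star_cartesian h k : star h = h -> star k = k ->
  star (h + 'i%C *: k) = h - 'i%C *: k.
Proof. by move=> sh sk; rewrite starD starZi sh sk. Qed.

(** As [h] and [k] commute, [u = h + i k] satisfies [star u * u = h^2 + k^2], and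
    [k] is the imaginary part of [u]. *)
Lemma rnorm_comm_sumsq h k : star h = h -> star k = k -> GRing.comm h k ->
  rnorm k ^+ 2 <= rnorm (h * h + k * k).
Proof.
move=> sh sk hk; pose u := h + 'i%C *: k.
have -> : h * h + k * k = star u * u.
  rewrite star_cartesian // /u mulrDr !mulrBl !mulZl !mulZr hk.
  by rewrite scaleii opprK addrA subrK.
rewrite rnorm_starM ler_sqr ?nnegrE ?rnorm_ge0 //.
have : 'i%C *: (k + k) = u - star u.
  by rewrite star_cartesian // /u opprB (addrC _ (- h)) addrACA subrr add0r scalerDr.
move/(congr1 rnorm); rewrite rnormZi -mulr2n -scaler_nat.
rewrite -(rmorph_nat (real_complex R)) rnormZ // => E.
have := rnormB u (star u); rewrite rnorm_star -E; lra.
Qed.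

(** After scaling to [|g| <= 1], the element [1 - g^2] has a root [k] commuting
    with [g]; then [g^2 + k^2 = 1] bounds [k], that is, it bounds [1 - g^2]. *)
Lemma positive_sqr h : star h = h -> positive (h * h).
Proof.
move=> sh; pose r := rnorm h + 1; have r0 : 0 < r by rewrite ltr_wpDl ?rnorm_ge0.
have rV0 : 0 <= r^-1 by rewrite invr_ge0 ltW.
have rN0 : r != 0 by rewrite gt_eqF.
pose g := r^-1%:C%C *: h.
have sg : star g = g by rewrite starZ sh.
have g1 : rnorm g <= 1 by rewrite rnormZ // mulrC ler_pdivrMr // mul1r lerDl.
have [||k [sk _ kk kz]] := @sqrt_unit R A (1 - g * g).
- by rewrite starB star1 starM sg.
- by rewrite opprB addrCA subrr addr0 rnorm_sqr_sa // expr_le1 ?rnorm_ge0.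
have gk : GRing.comm g k.
  by apply: kz; apply: commrB; [exact: commr1|exact: commrM].
have := rnorm_comm_sumsq sg sk gk.
rewrite kk addrCA subrr addr0 => k1.
split; first by rewrite starM sh.
exists (r ^+ 2); first exact: sqr_ge0.
have -> : (r ^+ 2)%:C%C *: (1 : A) - h * h = (r ^+ 2)%:C%C *: (k * k).
  rewrite kk scalerBr mulZl mulZr !scaleCA.
  have -> : r ^+ 2 / r / r = 1 by field.
  by rewrite scale1r.
rewrite rnormZ ?sqr_ge0 // rnorm_sqr_sa // ler_piMr ?sqr_ge0 //.
by rewrite (le_trans k1) // rnorm1_le1.
Qed.

(** Monotonicity of the norm. With [s = |a + b|] both [a] and [s - a] are
    positive, hence squares of commuting self-adjoint elements [k] and [l], and
    [k^2 + l^2 = s]. *)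
Lemma rnorm_positiveD a b : positive a -> positive b -> rnorm a <= rnorm (a + b).
Proof.
move=> pa pb; pose s := rnorm (a + b); have s0 : 0 <= s := rnorm_ge0 _.
pose c := s%:C%C *: (1 : A) - a.
have pc : positive c.
  have -> : c = (s%:C%C *: (1 : A) - (a + b)) + b by rewrite opprD addrA subrK.
  apply: positiveD => //; split.
    by rewrite starB starZ star1 starD pa.1 pb.1.
  by exists s => //; rewrite opprB addrCA subrr addr0.
have [k [[sk _] kk kz]] := positive_sqrt pa.
have [l [[sl _] ll lz]] := positive_sqrt pc.
have lk : GRing.comm l k.
  apply: kz; apply: commr_sym; apply: lz; apply: commrB => //; exact: commZ1.
have := rnorm_comm_sumsq sl sk lk.
rewrite kk ll subrK -rnorm_sqr_sa // kk => /le_trans; apply.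
exact: rnorm_scale1.
Qed.

Lemma positive_add_eq0 a b : positive a -> positive b -> a + b = 0 -> a = 0.
Proof.
move=> pa pb ab; apply: rnorm_eq0; apply/eqP; rewrite eq_le rnorm_ge0 andbT.
by rewrite -(@rnorm0 R A) -ab; exact: rnorm_positiveD.
Qed.

Lemma starM_cartesian x : exists b c, [/\ star b = b, star c = c &
  star x * x + x * star x = (b * b + c * c) + (b * b + c * c)].
Proof.
pose half : R[i] := (2^-1 : R)%:C%C.
pose b := half *: (x + star x); pose d := half *: (star x - x); pose c := 'i%C *: d.
have sb : star b = b by rewrite /b starZ starD starK addrC.
have sc : star c = c by rewrite starZi starZ starB starK -scalerN -scalerN opprB.
have xE : x = b - d.
  by rewrite -scalerBr opprB addrACA subrr addr0 half2.
have xsE : star x = b + d.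
  by rewrite -scalerDr (addrC x) addrACA subrr addr0 half2.
exists b, c; split=> //.
have -> : c * c = - (d * d) by rewrite mulZl mulZr scaleii.
rewrite xsE xE !mulrDl !mulrDr !mulrN !mulNr.
move: (b * b) (b * d) (d * b) (d * d) => p q r s.
rewrite (addrACA (p - q)) (addrACA p) (addrACA r) (addrACA p (- s)).
by rewrite addNr subrr addr0 add0r.
Qed.

(** The step of the Fukamiya-Kaplansky theorem usually drawn from the equality of
    the spectra of [xy] and [yx] away from zero. With [v] a root of [w] and
    [q = y v] one has [star q * q = - w^2] and [q * star q = - (y * star y)^2],
    whereas [star q * q + q * star q] is a sum of squares; positive elements with
    sum zero vanish. *)
Lemma starM_negative y w : positive w -> star y * y = - w -> y = 0.
Proof.
move=> pw yw; have [v [[sv _] vv _]] := positive_sqrt pw.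
have [sw _] := pw; pose p := y * star y.
have sp : star p = p by rewrite starM starK.
have [b [c [sb sc]]] := starM_cartesian (y * v).
have -> : star (y * v) * (y * v) = - (w * w).
  by rewrite starM sv mulrA -(mulrA v) yw mulrN mulNr -vv !mulrA.
have -> : y * v * star (y * v) = - (p * p).
  rewrite starM sv mulrA -(mulrA y) vv /p mulrA -(mulrA y (star y)) yw.
  by rewrite mulrN mulNr opprK.
set S := b * b + c * c => E.
have pS : positive (S + S) by do 2!apply: positiveD; apply: positive_sqr.
suff : w * w = 0.
  by move/(sqr_eq0_sa sw) => w0; apply: starM_eq0; rewrite yw w0 oppr0.
apply: (@positive_add_eq0 _ (p * p + (S + S))).
- exact: positive_sqr.
- by apply: positiveD => //; exact: positive_sqr.
- by rewrite -E addrA -opprD subrr.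
Qed.

(** With [a = star x * x], [m = |a|] and [d = m - a], the relation [a d = - m d]
    makes [star (x d) * (x d)] the negative of a square. Therefore [x d] vanishes,
    and so does [d]. *)
Lemma positive_starM x : positive (star x * x).
Proof.
set a := star x * x; have sa : star a = a by rewrite starM starK.
have [m [pm mm mz]] := positive_sqrt (positive_sqr sa).
have am : GRing.comm a m by apply: mz; exact: commrM.
have [n [[sn _] nn nz]] := positive_sqrt pm.
have an : GRing.comm a n := nz _ am.
have mn : GRing.comm m n := nz _ (erefl _).
have sm := pm.1; pose d := m - a.
have sd : star d = d by rewrite starB sm sa.
have dn : GRing.comm n d by apply: commrB; exact: commr_sym.
have ad : a * d = - (m * d).
  by rewrite !mulrBr mm am opprB.
have dad : star (x * d) * (x * d) = - ((n * d) * (n * d)).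
  rewrite starM sd mulrA -(mulrA d) -/a -mulrA ad mulrN -nn.
  by rewrite !mulrA -dn.
have snd : star (n * d) = n * d by rewrite starM sn sd dn.
have nd0 : n * d = 0.
  apply: (sqr_eq0_sa snd); apply/eqP; rewrite -oppr_eq0 -dad.
  by rewrite (starM_negative _ dad) ?mulr0 //; exact: positive_sqr.
have md0 : m * d = 0 by rewrite -nn -mulrA nd0 mulr0.
have d0 : d = 0.
  by apply: (sqr_eq0_sa sd); rewrite {1}/d mulrBl ad md0 oppr0 subrr.
by move/subr0_eq: d0 => <-.
Qed.

Lemma positive_sum (I : Type) (s : seq I) (P : pred I) (F : I -> A) :
  (forall i, P i -> positive (F i)) -> positive (\sum_(i <- s | P i) F i).
Proof. exact: (big_ind _ positive0 positiveD). Qed.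

Lemma rnorm_sum_starM (I : finType) (F : I -> A) i :
  rnorm (F i) ^+ 2 <= rnorm (\sum_j star (F j) * F j).
Proof.
rewrite (bigD1 i) //= -rnorm_starM; apply: rnorm_positiveD.
  exact: positive_starM.
by apply: positive_sum => j _; exact: positive_starM.
Qed.

End Positivity.


(** * *-homomorphisms *)

Section StarHom.
Context {R : realType} {A B : cstarAlgType R} (f : A -> B) (fhom : star_hom f).

Let flin := let: And3 l _ _ := fhom in l.
Let fmul := let: And3 _ m _ := fhom in m.
Let fstar := let: And3 _ _ s := fhom in s.

Lemma star_hom1 : f 1 = 1. Proof. exact: fmul.1. Qed.
Lemma star_homM x y : f (x * y) = f x * f y. Proof. exact: fmul.2. Qed.
Lemma star_homS x : f (star x) = star (f x). Proof. exact: fstar. Qed.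
Lemma star_hom0 : f 0 = 0.
Proof. by have := flin (-1) 0 0; rewrite scaler0 addr0 /= scaleN1r addNr. Qed.
Lemma star_homD x y : f (x + y) = f x + f y.
Proof. by have := flin 1 x y; rewrite !scale1r. Qed.
Lemma star_homZ c x : f (c *: x) = c *: f x.
Proof. by have := flin c x 0; rewrite star_hom0 !addr0. Qed.
Lemma star_homB x y : f (x - y) = f x - f y.
Proof. by rewrite star_homD -scaleN1r star_homZ scaleN1r. Qed.

(** For self-adjoint [h] of norm [s], the element [s^2 - h^2] is a square [k^2],
    so [f h ^2 + f k ^2 = s^2], and a sum of squares dominates its terms in
    norm. *)
Lemma star_hom_contractive a : rnorm (f a) <= rnorm a.
Proof.
rewrite -ler_sqr ?nnegrE ?rnorm_ge0 // -!rnorm_starM -star_homS -star_homM.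
set h := star a * a; have sh : star h = h by rewrite starM starK.
pose s := rnorm h; have s0 : 0 <= s := rnorm_ge0 _.
have p : positive ((s ^+ 2)%:C%C *: (1 : A) - h * h).
  split; first by rewrite starB starZ star1 starM sh.
  exists (s ^+ 2); first exact: sqr_ge0.
  by rewrite opprB addrCA subrr addr0 rnorm_sqr_sa.
have [k [[sk _] kk _]] := positive_sqrt p.
have sfh : star (f h) = f h by rewrite -star_homS sh.
rewrite -ler_sqr ?nnegrE ?rnorm_ge0 // -rnorm_sqr_sa //.
apply: le_trans (rnorm_positiveD (positive_sqr sfh) (@positive_sqr _ _ (f k) _)) _.
  by rewrite -star_homS sk.
rewrite -!star_homM kk star_homB star_homZ star_hom1 addrCA subrr addr0.
exact: rnorm_scale1 (sqr_ge0 _).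
Qed.

Lemma ideal_preimage (I : set B) : ideal I -> ideal (f @^-1` I).
Proof.
move=> [clI I0 ID IZ IM]; split => /=.
- apply: approx_closed => x xe; apply: closed_approx clI _ => e /xe[y Iy xy].
  exists (f y) => //; rewrite -star_homB; apply: le_lt_trans xy.
  exact: star_hom_contractive.
- by rewrite star_hom0.
- by move=> a b Ia Ib; rewrite star_homD; exact: ID.
- by move=> c a Ia; rewrite star_homZ; exact: IZ.
- by move=> a b Ia; rewrite !star_homM; exact: IM.
Qed.


End StarHom.

(** * Matrices and Cuntz subequivalence *)

Section Matrices.
Context {R : realType} {A : cstarAlgType R}.

Lemma gramE m n (x : 'M[A]_(m, n)) i j :
  (adjmx x *m x) i j = \sum_k star (x k i) * x k j.
Proof. by rewrite mxE; apply: eq_bigr => k _; rewrite !mxE. Qed.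

Lemma rnorm_le_cvnorm n (xi : 'cV[A]_n) i : rnorm (xi i ord0) <= cvnorm xi.
Proof.
rewrite /cvnorm gramE -(ger0_norm (rnorm_ge0 (xi i ord0))) -sqrtr_sqr.
by rewrite ler_wsqrtr // (rnorm_sum_starM (fun k => xi k ord0)).
Qed.

Lemma mxnorm0 m n : mxnorm (0 : 'M[A]_(m, n)) = 0%E.
Proof.
have cv0 k : cvnorm (0 : 'cV[A]_k) = 0.
  by rewrite /cvnorm mulmx0 mxE rnorm0 sqrtr0.
apply/eqP; rewrite eq_le; apply/andP; split.
  by apply: ge_ereal_sup => _ [xi _ <-]; rewrite mul0mx cv0.
by apply: ereal_sup_ubound; exists 0; rewrite /= ?mulmx0 cv0.
Qed.

Lemma rnorm_le_mxnorm m n (x : 'M[A]_(m, n)) i j :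
  ((rnorm (x i j))%:E <= mxnorm x)%E.
Proof.
apply: (@le_trans _ _ (cvnorm (x *m delta_mx j ord0))%:E).
  by rewrite lee_fin -colE (le_trans _ (rnorm_le_cvnorm _ i)) // mxE.
apply: ereal_sup_ubound; exists (delta_mx j ord0) => //=.
rewrite /cvnorm -[leRHS]sqrtr1 ler_wsqrtr // gramE (bigD1 j) //= big1 => [|k kj].
  by rewrite mxE !eqxx star1 addr0 mul1r rnorm1_le1.
by rewrite mxE (negbTE kj) mulr0.
Qed.

Lemma cuntz_sub_exact (a b : @Minf R A) v :
  mval a = adjmx v *m mval b *m v -> cuntz_sub a b.
Proof.
move=> ab; exists (fun=> v); rewrite -ab subrr mxnorm0; exact: cvg_cst.
Qed.

Lemma cuntz_sub_refl (a : @Minf R A) : cuntz_sub a a.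
Proof.
apply: (@cuntz_sub_exact _ _ 1%:M).
have -> : adjmx 1%:M = 1%:M :> 'M[A]_((msize a).+1).
  by apply/matrixP => i j; rewrite !mxE eq_sym; case: eqP; rewrite ?star1 ?star0.
by rewrite mul1mx mulmx1.
Qed.

(** Cuntz subequivalence respects ideals: [a] is a limit of matrices
    [v^* b v], and the norm of a matrix dominates its entries. *)
Lemma cuntz_sub_ideal (I : set A) (a b : @Minf R A) : ideal I -> cuntz_sub a b ->
  (forall i j, I (mval b i j)) -> forall i j, I (mval a i j).
Proof.
move=> [clI I0 ID IZ IM] [v va] Ib i j; apply: closed_approx clI _ => e e0.
have : nbhs (0%E : \bar R) [set x | (x < e%:E)%E].
  by apply: open_nbhs_nbhs; split; [exact: open_ereal_lt_ereal|rewrite /= lte_fin].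
move=> /va [N _ /(_ N (leqnn _)) /= H].
exists ((adjmx (v N) *m mval b *m v N) i j); last first.
  rewrite -rnormN opprB -lte_fin; apply: le_lt_trans H.
  by have := rnorm_le_mxnorm (adjmx (v N) *m mval b *m v N - mval a) i j; rewrite !mxE.
rewrite mxE; apply: (big_ind I) => // k _; apply: (IM _ _ _).2.
by rewrite mxE; apply: (big_ind I) => // l _; exact: (IM _ _ _).1.
Qed.

Lemma ideal0 : ideal [set (0 : A)].
Proof.
split=> //=.
- apply: approx_closed => x /= xe; apply: (@rnorm_small _ _ 1) => // e e0.
  by have [_ ->] := xe _ e0; rewrite subr0 mul1r => /ltW.
- by move=> a b -> ->; rewrite addr0.
- by move=> c a ->; rewrite scaler0.
- by move=> a b ->; rewrite mulr0 mul0r.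
Qed.

Lemma cuntz_sub_zero (a b : @Minf R A) : mval b = 0 -> cuntz_sub a b -> mval a = 0.
Proof.
move=> b0 ab; apply/matrixP => i j; rewrite mxE.
by apply: (cuntz_sub_ideal ideal0 ab) => k l; rewrite b0 mxE.
Qed.

Lemma cuntz_sub0l (a b : @Minf R A) : mval a = 0 -> cuntz_sub a b.
Proof. by move=> a0; apply: (@cuntz_sub_exact _ _ 0); rewrite mulmx0. Qed.

Lemma cuntz_class_eq0 (a : @Minf R A) : mval a = 0 -> cuntz_class a = cuntz_zero.
Proof.
move=> a0; apply/seteqP; split => b [pb [ab ba]]; split => //; split.
- exact: cuntz_sub0l.
- by apply: cuntz_sub0l; exact: cuntz_sub_zero ba.
- exact: cuntz_sub0l.
- by apply: cuntz_sub0l; exact: cuntz_sub_zero ba.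
Qed.

Lemma cuntz_class_mem (a : @Minf R A) : Minf_pos a -> cuntz_class a a.
Proof. by move=> pa; split=> //; split; exact: cuntz_sub_refl. Qed.

Lemma cuntz_class_zero (a : @Minf R A) : Minf_pos a ->
  cuntz_class a = cuntz_zero -> mval a = 0.
Proof.
move=> pa a0; have := cuntz_class_mem pa; rewrite a0 => -[_ [_]].
exact: cuntz_sub_zero.
Qed.

End Matrices.

(** * Annihilator ideals and primeness *)

Section Annihilator.
Context {R : realType} {B : cstarAlgType R}.

Lemma closed_mul_eq0 (K : set B) :
  closed [set x : B | forall y, K y -> x * y = 0].
Proof.
apply: approx_closed => x xe y Ky; apply: (@rnorm_small _ _ (rnorm y)).
  exact: rnorm_ge0.
move=> e /xe[z Kz /ltW xz]; rewrite -(subr0 (x * y)) -(Kz _ Ky) -mulrBl.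
by rewrite (le_trans (rnormM _ _)) // mulrC ler_wpM2l ?rnorm_ge0.
Qed.

Lemma ideal_left_annihilator (K : set B) :
  (forall b y, K y -> K (b * y)) -> ideal [set x : B | forall y, K y -> x * y = 0].
Proof.
move=> KM; split=> /=.
- exact: closed_mul_eq0.
- by move=> y _; rewrite mul0r.
- by move=> a b a0 b0 y Ky; rewrite mulrDl a0 // b0 // addr0.
- by move=> c a a0 y Ky; rewrite mulZl a0 // scaler0.
- move=> a b a0; split=> y Ky; first by rewrite -mulrA a0 // mulr0.
  by rewrite -mulrA a0 //; exact: KM.
Qed.

Lemma ideal_right_annihilator (a : B) :
  ideal [set y : B | forall w, a * w * y = 0].
Proof.
split=> /=.
- apply: approx_closed => y ye w.
  apply: (@rnorm_small _ _ (rnorm (a * w))); first exact: rnorm_ge0.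
  move=> e /ye[z az /ltW yz]; rewrite -(subr0 (_ * y)) -(az w) -mulrBr.
  by rewrite (le_trans (rnormM _ _)) // ler_wpM2l ?rnorm_ge0.
- by move=> w; rewrite mulr0.
- by move=> y z y0 z0 w; rewrite mulrDr y0 z0 addr0.
- by move=> c y y0 w; rewrite mulZr y0 scaler0.
- move=> y b y0; split=> w; last by rewrite mulrA y0 mul0r.
  by rewrite mulrA -(mulrA a) y0.
Qed.

(** If [a B b = 0], the right annihilator [K] of [a B] contains [b] and the left
    annihilator [L] of [K] contains [a]. An element [z] of both ideals satisfies
    [z * star z * z = 0], hence vanishes, against primeness. *)
Lemma prime_mul_neq0 (a b : B) : prime_cstar B -> a <> 0 -> b <> 0 ->
  exists w, a * w * b <> 0.
Proof.
move=> prB a0 b0; apply: contrapT => /forallNP ab.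
pose K := [set y : B | forall w, a * w * y = 0].
have idK : ideal K := ideal_right_annihilator a.
have [_ K0 _ _ KM] := idK.
pose L := [set x : B | forall y, K y -> x * y = 0].
have idL : ideal L by apply: ideal_left_annihilator => c y Ky; exact: (KM _ _ _).1.
have Kb : K b by move=> w; apply: contrapT; exact: ab.
have La : L a by move=> y /(_ 1); rewrite mulr1.
apply: (prB L K idL idK).
- by move=> L0; apply: a0; have := La; rewrite L0.
- by move=> K00; apply: b0; have := Kb; rewrite K00.
apply/seteqP; split=> [z [Lz Kz]|_ ->] /=; last first.
  by split=> // y _; rewrite mul0r.
apply: starM_eq0; set s := star z * z.
have ss : star s = s by rewrite starM starK.
apply: (sqr_eq0_sa ss).
rewrite {2}/s mulrA /s -(mulrA (star z)) -mulrA -(mulrA z) Lz ?mulr0 //.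
exact: (KM _ _ _).1.
Qed.

End Annihilator.

(** * The reduced crossed product *)

Section CrossedProduct.
Context {R : realType} {A : cstarAlgType R} {G : groupType}.
Context {alpha : cstar_action G A} (B : reduced_crossed_product alpha).

Local Notation emb := (@rcp_emb _ _ _ _ B).
Local Notation u := (@rcp_unit _ _ _ _ B).
Local Notation embH := (@rcp_emb_hom _ _ _ _ B).

Lemma act1 a : alpha 1%g a = a.
Proof.
have [g gK _] := act_bij alpha 1%g.
by apply: (can_inj gK); rewrite -act_mul mul1g.
Qed.

Lemma rcp_covariantE t a : u t * emb a = emb (alpha t a) * u t.
Proof.
rewrite -[emb (alpha t a)](@rcp_covariant _ _ _ _ B).
by rewrite -!mulrA (rcp_unitary B t).1 mulr1.
Qed.

(** The reduced norm of [a] carried by the unit of [G] is at least the norm of its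
    image of the unit vector there, which is [|a|]. *)
Lemma rcp_emb_eq0 a : emb a = 0 -> a = 0.
Proof.
move=> ea0; pose delta (x : A) (t : G) : A := if t == 1%g then x else 0.
pose f := delta a; pose xi := delta 1.
have delta_supp x : finsupp (delta x).
  apply: (sub_finite_set _ (finite_set1 1%g)) => t /=; rewrite /delta.
  by case: eqP.
have sum1 (F : G -> A) : (forall t, t != 1%g -> F t = 0) ->
    \sum_(t \in [set: G]) F t = F 1%g.
  move=> F0; rewrite -(fsbig_widen [set 1%g]) ?fsbig_set1 // => t /= [_ /eqP].
  exact: F0.
have := @rcp_norm _ _ _ _ B f (delta_supp a); rewrite fsbig1 => [|t _]; last first.
  rewrite /f /delta; case: eqP => _; first by rewrite ea0 mul0r.
  by rewrite (star_hom0 embH) mul0r.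
rewrite rnorm0 => nf.
have xi1 : l2norm xi <= 1.
  rewrite /l2norm sum1 => [|t /negbTE tN]; last by rewrite /xi /delta tN mulr0.
  by rewrite /xi /delta eqxx star1 mul1r -[leRHS]sqrtr1 ler_wsqrtr // rnorm1_le1.
have repE s : regular_rep alpha f xi s = alpha s^-1%g a * xi s.
  rewrite /regular_rep sum1 => [|t /negbTE tN].
    by rewrite /f /delta eqxx invg1 mul1g.
  by rewrite /f /delta tN (star_hom0 (act_star_hom _ _)) mul0r.
have : l2norm (regular_rep alpha f xi) <= 0.
  rewrite -lee_fin nf; apply: ereal_sup_ubound; exists xi => //; split=> //.
  exact: delta_supp.
rewrite /l2norm sum1 => [|s /negbTE sN]; last by rewrite repE /xi /delta sN !mulr0.
rewrite repE /xi /delta eqxx mulr1 invg1 act1 rnorm_starM sqrtr_sqr.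
rewrite ger0_norm ?rnorm_ge0 //.
by move=> a0; apply: rnorm_eq0; apply/eqP; rewrite eq_le a0 rnorm_ge0.
Qed.

(** Were all the products zero, [emb a * w * emb b] would vanish for [w] in the
    dense span of the elements [emb c * u t], hence for every [w]. *)
Lemma prime_act_mul_neq0 a b : prime_cstar B -> a <> 0 -> b <> 0 ->
  exists t c, a * c * alpha t b <> 0.
Proof.
move=> prB a0 b0; apply: contrapT => /forallNP ab.
have [||w wN0] := @prime_mul_neq0 R B (emb a) (emb b) prB.
- by move/rcp_emb_eq0.
- by move/rcp_emb_eq0.
apply: wN0; apply: (@rnorm_small _ _ (rnorm (emb a) * rnorm (emb b))).
  by rewrite mulr_ge0 ?rnorm_ge0.
move=> e e0; have [_ [f _ <-] wf] := dense_approx w (@rcp_dense _ _ _ _ B) e0.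
set v := (X in rnorm (w - X)) in wf.
have v0 : emb a * v * emb b = 0.
  apply: (big_ind (fun v : B => emb a * v * emb b = 0)).
  - by rewrite mulr0 mul0r.
  - by move=> x y x0 y0; rewrite mulrDr mulrDl x0 y0 addr0.
  move=> t _; rewrite !mulrA -(star_homM embH) -mulrA rcp_covariantE mulrA.
  rewrite -(star_homM embH); suff -> : a * f t * alpha t b = 0.
    by rewrite (star_hom0 embH) mul0r.
  by apply: contrapT => ftN0; apply: (ab t); exists (f t).
rewrite -(subr0 (emb a * w * emb b)) -v0 -mulrBl -mulrBr.
apply: le_trans (rnormM _ _) _; rewrite mulrAC ler_wpM2r ?rnorm_ge0 //.
by rewrite (le_trans (rnormM _ _)) // ler_wpM2l ?rnorm_ge0 // ltW.
Qed.

(** Compressing to a diagonal entry trades an element of a matrix algebra for an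
    element of [A] below it. *)
Lemma cuntz_sub_entry (x d : A) (b : @Minf R A) j :
  x = star d * mval b j j * d -> cuntz_sub (MkMinf (const_mx x : 'M[A]_1)) b.
Proof.
move=> xE.
apply: (@cuntz_sub_exact _ _ (MkMinf (const_mx x : 'M[A]_1)) b
          (\col_i (if i == j then d else 0))).
apply/matrixP => i i'; rewrite !mxE xE (bigD1 j) //= big1 => [|k /negbTE kj].
  rewrite addr0 !mxE eqxx; congr (_ * _).
  rewrite (bigD1 j) //= big1 ?addr0 => [|k /negbTE kj]; first by rewrite !mxE eqxx.
  by rewrite !mxE kj star0 mul0r.
by rewrite !mxE kj mulr0.
Qed.

(** Nonzero positive matrices have nonzero diagonal entries; write two of them as
    [r^2] and [s^2], and choose [t], [c] with [X = r c alpha_t(s)] nonzero. The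
    class sought is that of [h^2], where [h = star X * X]. If [m] is a root of
    [h], then [h^2 = m (star X * X) m] lies below [r^2], and
    [h^2 = star X * (X * star X) * X] lies below [alpha_t(s^2)]. Squaring [h]
    makes both relations exact, so that no approximation is needed. *)
Lemma prime_topologically_transitive :
  prime_cstar B -> topologically_transitive alpha.
Proof.
move=> prB _ _ [a pa <-] [b pb <-] a0 b0.
have diag (c : Minf) : Minf_pos c -> cuntz_class c <> cuntz_zero ->
    exists j (r : A), [/\ star r = r, r <> 0 & mval c j j = r * r].
  move=> [p cp] cN0; suff [j cj] : exists j, mval c j j <> 0.
    (* The entry is a sum of terms [star x * x], not visibly one such term. *)
    have [|r [[sr _] rr _]] := @positive_sqrt _ _ (mval c j j).
      by rewrite cp gramE; apply: positive_sum => k _; exact: positive_starM.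
    by exists j, r; split=> // r0; apply: cj; rewrite -rr r0 mulr0.
  apply: contrapT => /forallNP c0; apply: cN0; apply: cuntz_class_eq0.
  rewrite cp; suff -> : p = 0 by rewrite mulmx0.
  apply/matrixP => i j; rewrite mxE; apply: rnorm_eq0; apply/eqP.
  rewrite -sqrf_eq0 eq_le sqr_ge0 andbT.
  rewrite (le_trans (rnorm_sum_starM (fun k => p k j) i)) // -gramE -cp.
  by have /contrapT -> := c0 j; rewrite rnorm0.
have [j [r [sr r0 ar]]] := diag _ pa a0; have [l [s [ss s0 bs]]] := diag _ pb b0.
have [t [c XN0]] := prime_act_mul_neq0 prB r0 s0.
have sH := act_star_hom alpha; have sas : star (alpha t s) = alpha t s.
  by rewrite -(star_homS (sH t)) ss.
set X := r * c * alpha t s in XN0; pose h := star X * X.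
have sh : star h = h by rewrite starM starK.
have [m [[sm _] mm _]] := positive_sqrt (positive_starM X).
pose Z := MkMinf (const_mx (h * h) : 'M[A]_1).
have pZ : Minf_pos Z.
  by exists (const_mx h); apply/matrixP => i i'; rewrite !mxE big_ord1 !mxE sh.
have ZN0 : mval Z <> 0.
  by move/matrixP/(_ ord0 ord0); rewrite !mxE => /(sqr_eq0_sa sh)/starM_eq0.
exists t^-1%g, (cuntz_class Z); split.
- by exists Z.
- by move/(cuntz_class_zero pZ).
- exists Z, a; split; [exact: cuntz_class_mem|exact: cuntz_class_mem|].
  apply: (@cuntz_sub_entry _ (c * alpha t s * m) _ j).
  rewrite ar !starM sm sas -{1 2}/h.
  have -> : h * h = m * h * m by rewrite /h -mm !mulrA.
  by rewrite /h /X !starM sr sas !mulrA.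
exists (act_Minf alpha t^-1%g Z), b; split; [|exact: cuntz_class_mem|].
  by exists Z => //; exact: cuntz_class_mem.
rewrite /act_Minf /= map_const_mx.
apply: (@cuntz_sub_entry _ (alpha t^-1%g (star c * r * X)) _ l).
have -> : mval b l l = alpha t^-1%g (alpha t (mval b l l)).
  by rewrite -act_mul mulVg act1.
rewrite -(star_homS (sH _)) -!(star_homM (sH _)); congr (alpha _ _).
rewrite bs (star_homM (sH t)) /h {2}/X {3}/X.
by rewrite !starM starK sr sas !mulrA.
Qed.

(** Nonzero ideals [I] and [J] of the crossed product meet [A]. Transitivity
    applied to a nonzero element of each gives a nonzero class [z] below both, up
    to [alpha_t]. For a suitable representative of [z], the entries of its image
    by [alpha_t] lie in [J] by one relation; they lie in [I] by the other, because
    [alpha_t] is conjugation by a unitary of the crossed product. *)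
Lemma topologically_transitive_prime :
  intersection_property B -> topologically_transitive alpha -> prime_cstar B.
Proof.
move=> ipB tt I J idI idJ IN0 JN0 IJ0.
have pick (K : set B) : ideal K -> K <> [set 0] ->
    exists2 a : A, a <> 0 & K (emb a).
  move=> idK KN0; apply: contrapT => none; apply: (ipB K idK KN0).
  apply/seteqP; split=> [x [Kx [a _ ax]]|_ ->] /=.
    rewrite -ax in Kx *; suff -> : a = 0 by exact: (star_hom0 embH).
    by apply: contrapT => a0; apply: none; exists a.
  by split; [case: idK|exists 0 => //; exact: (star_hom0 embH)].
have [a a0 Ia] := pick _ idI IN0; have [b b0 Jb] := pick _ idJ JN0.
pose M (c : A) := MkMinf (const_mx (star c * c) : 'M[A]_1).
have pM c : Minf_pos (M c).
  by exists (const_mx c); apply/matrixP => i i'; rewrite !mxE big_ord1 !mxE.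
have MN0 c : c <> 0 -> cuntz_class (M c) <> cuntz_zero.
  move=> cN0 /(cuntz_class_zero (pM c))/matrixP/(_ ord0 ord0).
  by rewrite !mxE => /starM_eq0.
have sub_entries (K : set B) c x d : ideal K -> K (emb c) ->
    cuntz_class (M c) x -> cuntz_sub d x -> forall i j, K (emb (mval d i j)).
  move=> idK Kc [_ [_ xM]] dx.
  have idP := ideal_preimage embH idK.
  apply: (cuntz_sub_ideal idP dx (cuntz_sub_ideal idP xM _)) => i j /=.
  have [_ _ _ _ KM] := idK; rewrite mxE (star_homM embH); exact: (KM _ _ Kc).1.
have [t [_ [[d pd <-] dN0 [d1 [x [dd1 xa d1x]]] [_ [y [[d2 dd2 <-] yb d2y]]]]]] :=
  tt _ _ (imageP _ (pM a)) (imageP _ (pM b)) (MN0 _ a0) (MN0 _ b0).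
have Id1 := sub_entries _ _ _ _ idI Ia xa d1x.
have Jd2 := sub_entries _ _ _ _ idJ Jb yb d2y.
have idP := ideal_preimage embH idI.
have Id2 i j : I (emb (mval d2 i j)).
  have [[_ [_ d2d]] [_ [dd1' _]]] := (dd2, dd1).
  exact: (cuntz_sub_ideal idP d2d (cuntz_sub_ideal idP dd1' Id1)).
have d2N0 : mval d2 <> 0.
  by move=> z; apply: dN0; apply: cuntz_class_eq0; exact: (cuntz_sub_zero z dd2.2.1).
apply: d2N0; apply/matrixP => i j; rewrite mxE.
suff : alpha t (mval d2 i j) = 0.
  have [g gK _] := act_bij alpha t.
  by move=> x0; apply: (can_inj gK); rewrite x0 (star_hom0 (act_star_hom alpha t)).
apply: rcp_emb_eq0; suff : (I `&` J) (emb (alpha t (mval d2 i j))) by rewrite IJ0.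
split; last by have := Jd2 i j; rewrite /= mxE.
rewrite -(@rcp_covariant _ _ _ _ B); case: idI => _ _ _ _ IM.
by apply: (IM _ _ _).2; apply: (IM _ _ _).1.
Qed.

End CrossedProduct.

Theorem theorem3p12 (R : realType) (A : cstarAlgType R) (G : groupType)
    (alpha : cstar_action G A) (B : reduced_crossed_product alpha)
    (A_separable : separable A) (G_countable : countable [set: G]) :
  (prime_cstar B -> topologically_transitive alpha) /\
  (intersection_property B -> topologically_transitive alpha -> prime_cstar B).
Proof.
split; [exact: prime_topologically_transitive|exact: topologically_transitive_prime].
Qed.
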